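(* Let $E$ and $F$ be nonempty closed convex sets in a real Hilbert space $H$. The following assertions are equivalent. (a) Every vector $u \in H$ is expressible as $u = p_E(u) + p_F(u)$, where $p_E(u)$ and $p_F(u)$ are the metric projections of $u$ on $E$ and $F$, respectively. (b) $E$ and $F$ are convex cones which are polar of each other, i.e. $E = F^\circ$ and $F = E^\circ$.
   Context: $H$ is a real Hilbert space with scalar product $\langle\cdot,\cdot\rangle$ and origin $o$. For a nonempty closed convex set $E\subseteq H$ and $u\in H$, the metric projection $p_E(u)$ is the unique vector of $E$ nearest to $u$. A nonempty convex set $C\subseteq H$ is a convex cone if $\lambda x\in C$ whenever $\lambda\geqslant 0$ and $x\in C$ (so $o\in C$). The (negative) polar set of a nonempty set $X\subseteq H$ is $X^\circ=\{x\in H:\langle x,e\rangle\leqslant 0\ \ \forall\, e\in X\}$. Convex cones $C$ and $D$ are polar of each other if $C=D^\circ$ and $D=C^\circ$. *)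

(* Defs.v *)
From HB Require Import structures.
From mathcomp Require Import all_boot all_order all_algebra sesquilinear.
From mathcomp Require Import boolp classical_sets reals topology normedtype convex.

Set Implicit Arguments.
Unset Strict Implicit.
Unset Printing Implicit Defensive.

Import Order.TTheory GRing.Theory Num.Theory.
Import numFieldNormedType.Exports.

Local Open Scope classical_set_scope.
Local Open Scope ring_scope.

(* A real Hilbert space is a complete normed module [H] over [R : realType]
   whose norm is induced by a symmetric positive definite bilinear form. *)
Definition norm_induced_by (R : realType) (H : completeNormedModType R)
    (dot : {dot H for idfun}) : Prop :=
  forall x : H, `|x| = Num.sqrt (dot x x).

Definition nearest (R : realType) (H : completeNormedModType R)
    (E : set H) (u : H) : set H :=
  [set p | E p /\ forall x, E x -> `|u - p| <= `|u - x|].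

(* The default value [0] is irrelevant when [E] is a nonempty closed convex
   set of a Hilbert space: [nearest E u] is then a singleton. *)
Definition metric_proj (R : realType) (H : completeNormedModType R)
    (E : set H) (u : H) : H :=
  xget 0 (nearest E u).

Definition convex_cone (R : realType) (H : completeNormedModType R)
    (C : set H) : Prop :=
  [/\ C !=set0, @convex_set R H C &
      forall (l : R) (x : H), 0 <= l -> C x -> C (l *: x)].

Definition polar (R : realType) (H : completeNormedModType R)
    (dot : {dot H for idfun}) (X : set H) : set H :=
  [set x | forall e, X e -> dot x e <= 0].

(* Main.v *)
(** For a convex set [E], [p] is a nearest point of [E] to [u] iff [p] lies in
    [E] and [<u - p, x - p> <= 0] for all [x] in [E].

    If [u = P u + Q u] for all [u], with [P], [Q] the projections on [E], [F],
    then [u - P u = Q u].  Taking [u = x] in [E] gives [Q x = 0], so [0] lies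
    in [F] (and likewise in [E]); the variational inequality for [Q] at [x] then
    reads [<x, y> <= 0] for [y] in [F], so [E] is contained in the polar of [F].
    Conversely, if [u] is in the polar of [F], then
    [|Q u|^2 = <u, Q u> - <P u, Q u> <= 0], because [<Q u, 0 - P u> <= 0]; hence
    [u = P u] lies in [E].  The converse implication is Moreau's decomposition
    theorem. *)
Require Import Defs.
From HB Require Import structures.
From mathcomp Require Import all_boot all_order all_algebra sesquilinear.
From mathcomp Require Import boolp classical_sets reals topology normedtype convex.
From mathcomp Require Import interval_inference lra.

Set Implicit Arguments.
Unset Strict Implicit.
Unset Printing Implicit Defensive.

Import Order.TTheory GRing.Theory Num.Theory.
Import numFieldNormedType.Exports.

Local Open Scope classical_set_scope.
Local Open Scope ring_scope.

(** Trades the interval-typed coefficient of [convex_set] for a real [t] with explicit bounds. *)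
Lemma convex_setP (R : realType) (H : lmodType R) (E : set H) :
  @convex_set R H E ->
  forall (x y : H) (t : R), E x -> E y -> 0 <= t -> t <= 1 ->
  E (t *: x + (1 - t) *: y).
Proof.
move=> Ecv x y t Ex Ey t0 t1.
have := Ecv x y (Itv01 t0 t1) (mem_set Ex) (mem_set Ey).
by move/set_mem.
Qed.

Section InnerProduct.
Variables (R : realType) (H : completeNormedModType R).
Variables (dot : {dot H for idfun}) (dotE : norm_induced_by dot).
Implicit Types (E F : set H) (u v p x y : H).

Lemma dotC x y : dot x y = dot y x.
Proof. by rewrite hermC expr0 mul1r. Qed.

(** [linearDl] and its kin leave the form coerced to [Bilinear.type], which
    blocks later rewriting; the [dot] variants keep it in [Dot.type]. *)
Lemma dotDl x y v : dot (x + y) v = dot x v + dot y v.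
Proof. exact: linearDl. Qed.

Lemma dotDr x y v : dot v (x + y) = dot v x + dot v y.
Proof. exact: linearDr. Qed.

Lemma dotBl x y v : dot (x - y) v = dot x v - dot y v.
Proof. exact: linearBl. Qed.

Lemma dotBr x y v : dot v (x - y) = dot v x - dot v y.
Proof. exact: linearBr. Qed.

Lemma dotNr x v : dot v (- x) = - dot v x.
Proof. exact: linearNr. Qed.

Lemma dot0l v : dot 0 v = 0.
Proof. exact: linear0l. Qed.

Lemma dotZl t x y : dot (t *: x) y = t * dot x y.
Proof. exact: linearZl_LR. Qed.

Lemma dotZr t x y : dot x (t *: y) = t * dot x y.
Proof. exact: linearZr_LR. Qed.

Lemma dot_ge0 x : 0 <= dot x x.
Proof.
by have [->|/(@neq0_dnorm_gt0 _ _ _ dot)/ltW//] := eqVneq x 0; rewrite dot0l.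
Qed.

Lemma dot_le0_eq0 x : dot x x <= 0 -> x = 0.
Proof. by apply: contraTeq => /(@neq0_dnorm_gt0 _ _ _ dot); rewrite ltNge. Qed.

Lemma sqr_norm_dot x : `|x| ^+ 2 = dot x x.
Proof. by rewrite dotE sqr_sqrtr// dot_ge0. Qed.

Lemma sqr_normB x y : `|x - y| ^+ 2 = `|x| ^+ 2 - 2 * dot x y + `|y| ^+ 2.
Proof.
rewrite !sqr_norm_dot dotBl !dotBr (dotC y x); lra.
Qed.

Lemma parallelogram x y :
  `|x + y| ^+ 2 + `|x - y| ^+ 2 = 2 * `|x| ^+ 2 + 2 * `|y| ^+ 2.
Proof.
rewrite !sqr_norm_dot dotBl dotDl !dotBr !dotDr; lra.
Qed.

Lemma nearestP E u p : @convex_set R H E ->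
  nearest E u p <-> E p /\ forall x, E x -> dot (u - p) (x - p) <= 0.
Proof.
move=> Ecv; split=> -[Ep pE]; split=> // x Ex; last first.
  rewrite -(@ler_pXn2r _ 2)// ?nnegrE//.
  have -> : u - x = (u - p) - (x - p) by rewrite opprB addrA subrK.
  have := pE _ Ex; have := sqr_ge0 `|x - p|; rewrite (sqr_normB (u - p)); lra.
rewrite leNgt; apply/negP; set c := dot _ _ => c0.
set B := `|x - p| ^+ 2; have B0 : 0 <= B by exact: sqr_ge0.
have Bc0 : 0 < B + c by lra.
(* Comparing [p] with the point at parameter [t] on the segment towards [x] gives [2 * c <= t * B],
   whereas this [t] has [t * B = c - t * c < c]. The summand [c] in the denominator ensures [t <= 1]
   and spares a proof that [B] is nonzero. *)
set t := c / (B + c).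
have tBc : t * (B + c) = c by rewrite divfK// gt_eqF.
have t0 : 0 < t by rewrite divr_gt0.
have t1 : t <= 1 by rewrite ler_pdivrMr// mul1r; lra.
have /pE := convex_setP Ecv Ex Ep (ltW t0) t1.
have -> : u - (t *: x + (1 - t) *: p) = (u - p) - t *: (x - p).
  by rewrite scalerBl scale1r addrCA -scalerBr opprD addrA.
rewrite -(@ler_pXn2r _ 2)// ?nnegrE// (sqr_normB (u - p)) dotZr.
rewrite normrZ exprMn real_normK ?num_real// -/B -/c.
nra.
Qed.

(** The variational inequalities of [p] at [q] and of [q] at [p] add up to
    [dot (p - q) (p - q) <= 0]. *)
Lemma nearest_unique E u p q : @convex_set R H E ->
  nearest E u p -> nearest E u q -> p = q.
Proof.
move=> Ecv /(nearestP _ _ Ecv)[Ep pE] /(nearestP _ _ Ecv)[Eq qE].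
apply/subr0_eq/dot_le0_eq0.
have := pE _ Eq; have := qE _ Ep.
rewrite !dotBl !dotBr (dotC q p); lra.
Qed.

(** The sets [A e] of near-minimizers generate a filter [G], in place of a minimizing sequence; [G]
    is Cauchy by the parallelogram law, and its limit is a nearest point. *)
Lemma nearest_exists E u : E !=set0 -> closed E -> @convex_set R H E ->
  nearest E u !=set0.
Proof.
move=> [x0 Ex0] Ecl Ecv.
pose S := [set `|u - x| ^+ 2 | x in E]; pose D := inf S.
have hS : has_inf S.
  split; first by exists (`|u - x0| ^+ 2), x0.
  by exists 0 => _ [x _ <-]; exact: sqr_ge0.
have Dle x : E x -> D <= `|u - x| ^+ 2.
  by move=> Ex; apply: ge_inf; [exact: hS.2|exists x].
pose A (e : R) := [set x | E x /\ `|u - x| ^+ 2 < D + e].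
pose G := filter_from [set e : R | 0 < e] A.
have GF : ProperFilter G.
  apply: filter_from_proper; last first.
    by move=> e /= e0; have [_ [x Ex <-] xD] := inf_adherent e0 hS; exists x.
  apply: filter_from_filter; first by exists 1 => /=.
  move=> a b /= a0 b0; exists (Num.min a b); first by rewrite /= lt_min a0 b0.
  by move=> x [Ex]; rewrite addr_minr lt_min => /andP[].
have /cauchy_cvgP : cauchy G.
  apply: cauchy_exP => e e0.
  (* The midpoint of [x] and [y] lies in [E], at squared distance at least [D] from [u], so [|x -
     y|^2 < 4 * (D + e^2 / 4) - 4 * D = e^2]. *)
  have d0 : 0 < e ^+ 2 / 4 by rewrite divr_gt0// exprn_gt0.
  have [_ [x Ex <-] xD] := inf_adherent d0 hS.
  exists x, (e ^+ 2 / 4) => // y [Ey yD].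
  rewrite -ball_normE /=.
  rewrite -(@ltr_pXn2r _ 2)// ?nnegrE// ?(ltW e0)//.
  have := parallelogram (u - y) (u - x).
  have -> : u - y - (u - x) = x - y by rewrite opprB addrC addrA subrK.
  have -> : u - y + (u - x) = 2 *: (u - (2^-1 *: x + (1 - 2^-1) *: y)).
    have -> : 1 - 2^-1 = 2^-1 :> R by lra.
    rewrite -scalerDr scalerBr scalerA divff// scale1r -[2]/(1 + 1).
    by rewrite scalerDl scale1r opprD addrACA [- x - y]addrC.
  rewrite normrZ exprMn real_normK ?num_real//.
  have /Dle : E (2^-1 *: x + (1 - 2^-1) *: y).
    by apply: convex_setP => //; lra.
  move: xD yD; rewrite -/D; lra.
move=> /cvg_ex[p Gp]; exists p; split.
  have GE : G E by exists 1 => [|x []] /=.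
  exact: (closed_cvg E Ecl GE _ Gp).
move=> x Ex; rewrite -(@ler_pXn2r _ 2)// ?nnegrE//.
apply: le_trans (Dle _ Ex); apply/ler_addgt0Pr => e e0.
have Gup : (`|u - y| ^+ 2) @[y --> G] --> `|u - p| ^+ 2.
  have Gn : `|u - y| @[y --> G] --> `|u - p|.
    by apply: cvg_norm; apply: cvgB; [exact: cvg_cst|exact: Gp].
  exact: (cvgM Gn Gn).
have Ge : G [set y | `|u - y| ^+ 2 <= D + e] by exists e => // y [_ /ltW].
exact: (closed_cvg [set r | r <= D + e] (@closed_le _ _) Ge _ Gup).
Qed.

Lemma metric_projP E u : E !=set0 -> closed E -> @convex_set R H E ->
  E (metric_proj E u) /\
  forall x, E x -> dot (u - metric_proj E u) (x - metric_proj E u) <= 0.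
Proof.
move=> E0 Ecl Ecv; apply/(nearestP _ _ Ecv).
by have [p pE] := nearest_exists u E0 Ecl Ecv; apply: xgetPex; exists p.
Qed.

Lemma metric_projE E u p : @convex_set R H E ->
  E p -> (forall x, E x -> dot (u - p) (x - p) <= 0) -> metric_proj E u = p.
Proof.
move=> Ecv Ep pE; have np : nearest E u p by apply/nearestP.
by apply: (@nearest_unique E u) => //; apply: xgetPex; exists p.
Qed.

Lemma convex_cone_polar X : convex_cone (polar dot X).
Proof.
split; first by exists 0 => x _; rewrite dot0l.
- move=> x y t /set_mem px /set_mem py; apply/mem_set => e Xe.
  change (dot (t%:num *: x + (1 - t%:num) *: y) e <= 0).
  rewrite dotDl !dotZl.
  by rewrite -oppr_ge0 opprD addr_ge0// oppr_ge0 mulr_ge0_le0 ?px ?py// subr_ge0.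
- by move=> t x t0 px e Xe; rewrite dotZl mulr_ge0_le0// px.
Qed.

Lemma eq_polar_of_decomposition E F :
  E !=set0 -> closed E -> @convex_set R H E ->
  F !=set0 -> closed F -> @convex_set R H F ->
  (forall u, u = metric_proj E u + metric_proj F u) ->
  E = polar dot F.
Proof.
move=> E0 Ecl Ecv F0 Fcl Fcv EF.
have PE u := metric_projP u E0 Ecl Ecv.
have PF u := metric_projP u F0 Fcl Fcv.
have subE u : u - metric_proj E u = metric_proj F u.
  by rewrite {1}[u]EF addrC addKr.
have projE x : E x -> metric_proj E x = x.
  by move=> Ex; apply: metric_projE => // y _; rewrite subrr dot0l.
have projF y : F y -> metric_proj F y = y.
  by move=> Fy; apply: metric_projE => // x _; rewrite subrr dot0l.
have projFE x : E x -> metric_proj F x = 0.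
  by move=> Ex; rewrite -subE projE// subrr.
(* For [y] in [F], the decomposition of [y] makes its projection on [E] vanish. *)
have Eo : E 0.
  have [y Fy] := F0; have := (PE y).1.
  have /eqP := subE y; rewrite projF// subr_eq addrC -subr_eq subrr eq_sym.
  by move/eqP ->.
apply/seteqP; split=> [x Ex y Fy|u uF].
  by have := (PF x).2 _ Fy; rewrite projFE// !subr0.
have Qu0 : metric_proj F u = 0.
  apply: dot_le0_eq0.
  have := uF _ (PF u).1; have := (PE u).2 _ Eo.
  have : dot u (metric_proj F u) = dot (metric_proj E u) (metric_proj F u) +
    dot (metric_proj F u) (metric_proj F u) by rewrite -dotDl -EF.
  rewrite subE sub0r dotNr oppr_le0 (dotC (metric_proj E u)); lra.
by rewrite [u]EF Qu0 addr0; exact: (PE u).1.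
Qed.

Lemma moreau_decomposition E F u : convex_cone E -> closed E ->
  @convex_set R H F -> F = polar dot E ->
  u = metric_proj E u + metric_proj F u.
Proof.
move=> [E0 Ecv Econe] Ecl Fcv FE.
have [] := metric_projP u E0 Ecl Ecv; set p := metric_proj E u => Ep pE.
(* The variational inequality at [0] and at [2 *: p], both in the cone, bounds this product from
   both sides. *)
have orth : dot (u - p) p = 0.
  have := pE _ (Econe 0 p (lexx 0) Ep).
  have := pE _ (Econe 2 p (ler0n _ 2) Ep).
  rewrite !dotBr !dotZr; lra.
have pol x : E x -> dot (u - p) x <= 0.
  by move=> Ex; have := pE _ Ex; rewrite dotBr orth subr0.
(* By [pol], [u - p] lies in [F]; by [orth], its variational inequality at [y] reduces to
   [dot p y <= 0], which holds as [p] is in [E]. *)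
rewrite (@metric_projE F u (u - p))//; first by rewrite addrC subrK.
  by rewrite FE.
rewrite FE => y yE; rewrite subKr dotBr [dot p (_ - _)]dotC orth subr0.
by rewrite dotC; exact: yE.
Qed.

End InnerProduct.

Theorem theorem1p2 (R : realType) (H : completeNormedModType R)
    (dot : {dot H for idfun}) (dotE : norm_induced_by dot)
    (E F : set H)
    (E0 : E !=set0) (Ecl : closed E) (Ecv : @convex_set R H E)
    (F0 : F !=set0) (Fcl : closed F) (Fcv : @convex_set R H F) :
  (forall u : H, u = metric_proj E u + metric_proj F u) <->
  [/\ convex_cone E, convex_cone F, E = polar dot F & F = polar dot E].
Proof.
split=> [EF|[Econe _ _ FE] u]; last exact: moreau_decomposition FE.
have EpF : E = polar dot F by exact: eq_polar_of_decomposition.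
have FpE : F = polar dot E.
  (* The decomposition is symmetric in [E] and [F]. *)
  by apply: eq_polar_of_decomposition => // u; rewrite addrC.
by split=> //; [rewrite EpF|rewrite FpE]; exact: convex_cone_polar.
Qed.
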